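(* In the un-typed $\overline{\lambda}\mu\tilde{\mu}$-calculus, the $\mu\tilde{\mu}$-reduction is strongly normalizing: no ($c$-, $l$- or $r$-) term has an infinite sequence of $\mu\tilde{\mu}$-reduction steps.
   Context: Syntax of the un-typed $\overline{\lambda}\mu\tilde{\mu}$-calculus. There are $l$-variables $x,y,\dots$ and $r$-variables $\alpha,\beta,\dots$, and three kinds of terms: $c ::= \langle t_l,t_r\rangle$ ($c$-terms); $t_l ::= x \mid \lambda x\, t_l \mid \mu\alpha\, c \mid t_r.t_l$ ($l$-terms); $t_r ::= \alpha \mid \lambda\alpha\, t_r \mid \mu x\, c \mid t_l.t_r$ ($r$-terms). The constructors $\lambda x,\lambda\alpha,\mu x,\mu\alpha$ bind their variable; terms are considered up to renaming of bound variables and substitution is capture-avoiding. The $\mu\tilde\mu$-reduction is the closure under all term constructors of the two rules $\langle\mu\alpha\,c,\,t_r\rangle\triangleright_{\mu}c[\alpha:=t_r]$ and $\langle t_l,\,\mu x\,c\rangle\triangleright_{\tilde\mu}c[x:=t_l]$. *)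

(* Defs.v *)
(* Plain Rocq; nothing beyond the prelude is needed.

   Terms up to renaming of bound variables are represented with de Bruijn
   indices.  There are two independent index spaces, one for l-variables and
   one for r-variables: an occurrence of an l-variable (r-variable) counts only
   the enclosing binders of l-variables (r-variables).  Free variables are the
   indices that exceed the number of enclosing binders of their kind, so all
   terms, open or closed, are represented. *)

Inductive cterm : Type :=
| cut (t : lterm) (u : rterm)   (* < t_l , t_r > *)
with lterm : Type :=
| lvar (n : nat)                (* x *)
| llam (t : lterm)              (* lambda x t_l, binds l-index 0 *)
| lmu (c : cterm)               (* mu alpha c, binds r-index 0 *)
| lapp (u : rterm) (t : lterm)  (* t_r . t_l *)
with rterm : Type :=
| rvar (n : nat)                (* alpha *)
| rlam (u : rterm)              (* lambda alpha t_r, binds r-index 0 *)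
| rmu (c : cterm)               (* mu x c, binds l-index 0 *)
| rapp (t : lterm) (u : rterm). (* t_l . t_r *)

Definition scons {A : Type} (a : A) (s : nat -> A) (n : nat) : A :=
  match n with 0 => a | S m => s m end.

Definition up_ren (xi : nat -> nat) : nat -> nat :=
  scons 0 (fun n => S (xi n)).

(* Simultaneous renaming: [xi] acts on l-variables, [zeta] on r-variables. *)
Fixpoint cren (xi zeta : nat -> nat) (c : cterm) : cterm :=
  match c with
  | cut t u => cut (lren xi zeta t) (rren xi zeta u)
  end
with lren (xi zeta : nat -> nat) (t : lterm) : lterm :=
  match t with
  | lvar n => lvar (xi n)
  | llam t => llam (lren (up_ren xi) zeta t)
  | lmu c => lmu (cren xi (up_ren zeta) c)
  | lapp u t => lapp (rren xi zeta u) (lren xi zeta t)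
  end
with rren (xi zeta : nat -> nat) (u : rterm) : rterm :=
  match u with
  | rvar n => rvar (zeta n)
  | rlam u => rlam (rren xi (up_ren zeta) u)
  | rmu c => rmu (cren (up_ren xi) zeta c)
  | rapp t u => rapp (lren xi zeta t) (rren xi zeta u)
  end.

(* Going under a binder of one kind shifts the free variables of that kind in
   the values of both substitutions; only the substitution of that kind gets a
   new entry for the bound variable. *)
Definition up_ll (s : nat -> lterm) : nat -> lterm :=
  scons (lvar 0) (fun n => lren S (fun k => k) (s n)).
Definition up_lr (r : nat -> rterm) : nat -> rterm :=
  fun n => rren S (fun k => k) (r n).
Definition up_rl (s : nat -> lterm) : nat -> lterm :=
  fun n => lren (fun k => k) S (s n).
Definition up_rr (r : nat -> rterm) : nat -> rterm :=
  scons (rvar 0) (fun n => rren (fun k => k) S (r n)).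

(* Simultaneous capture-avoiding substitution: [s] replaces l-variables,
   [r] replaces r-variables. *)
Fixpoint csubst (s : nat -> lterm) (r : nat -> rterm) (c : cterm) : cterm :=
  match c with
  | cut t u => cut (lsubst s r t) (rsubst s r u)
  end
with lsubst (s : nat -> lterm) (r : nat -> rterm) (t : lterm) : lterm :=
  match t with
  | lvar n => s n
  | llam t => llam (lsubst (up_ll s) (up_lr r) t)
  | lmu c => lmu (csubst (up_rl s) (up_rr r) c)
  | lapp u t => lapp (rsubst s r u) (lsubst s r t)
  end
with rsubst (s : nat -> lterm) (r : nat -> rterm) (u : rterm) : rterm :=
  match u with
  | rvar n => r n
  | rlam u => rlam (rsubst (up_rl s) (up_rr r) u)
  | rmu c => rmu (csubst (up_ll s) (up_lr r) c)
  | rapp t u => rapp (lsubst s r t) (rsubst s r u)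
  end.

(* c[x := t] and c[alpha := u], where the substituted variable is the one with
   index 0; the binder disappears, so the other indices of its kind drop by
   one. *)
Definition csubst_l (t : lterm) (c : cterm) : cterm :=
  csubst (scons t lvar) rvar c.
Definition csubst_r (u : rterm) (c : cterm) : cterm :=
  csubst lvar (scons u rvar) c.

Inductive cred : cterm -> cterm -> Prop :=
| cred_mu (c : cterm) (u : rterm) :
    cred (cut (lmu c) u) (csubst_r u c)
| cred_mutilde (t : lterm) (c : cterm) :
    cred (cut t (rmu c)) (csubst_l t c)
| cred_cut_l (t t' : lterm) (u : rterm) :
    lred t t' -> cred (cut t u) (cut t' u)
| cred_cut_r (t : lterm) (u u' : rterm) :
    rred u u' -> cred (cut t u) (cut t u')
with lred : lterm -> lterm -> Prop :=
| lred_lam (t t' : lterm) : lred t t' -> lred (llam t) (llam t')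
| lred_mu (c c' : cterm) : cred c c' -> lred (lmu c) (lmu c')
| lred_app_r (u u' : rterm) (t : lterm) :
    rred u u' -> lred (lapp u t) (lapp u' t)
| lred_app_l (u : rterm) (t t' : lterm) :
    lred t t' -> lred (lapp u t) (lapp u t')
with rred : rterm -> rterm -> Prop :=
| rred_lam (u u' : rterm) : rred u u' -> rred (rlam u) (rlam u')
| rred_mu (c c' : cterm) : cred c c' -> rred (rmu c) (rmu c')
| rred_app_l (t t' : lterm) (u : rterm) :
    lred t t' -> rred (rapp t u) (rapp t' u)
| rred_app_r (t : lterm) (u u' : rterm) :
    rred u u' -> rred (rapp t u) (rapp t u').

Definition strongly_normalizing {A : Type} (R : A -> A -> Prop) (a : A) : Prop :=
  ~ exists f : nat -> A, f 0 = a /\ forall n : nat, R (f n) (f (S n)).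

(* Main.v *)
(* Symmetric reducibility candidates.  Since no rule acts on lambda or on the
   application constructors, one pair (X, Y) of sets of l-terms and r-terms is
   enough, as if all terms had the same atomic type.  X consists of the strongly
   normalizing t such that t = mu alpha c implies that c[alpha := u] is strongly
   normalizing for all u in Y, and Y is described symmetrically from X.  Both
   descriptions are antitone, so their composite is monotone and has a fixed
   point.  By construction <t, u> is strongly normalizing for t in X and u in Y,
   and an induction on terms shows that substituting elements of X and Y always
   gives elements of X, elements of Y, or strongly normalizing c-terms. *)

Require Import Defs.
From Stdlib Require Import FunctionalExtensionality.

(* Mutual induction principles for terms and reduction *)
Scheme cterm_mut := Induction for cterm Sort Prop
  with lterm_mut := Induction for lterm Sort Prop
  with rterm_mut := Induction for rterm Sort Prop.
Combined Scheme term_mutind from cterm_mut, lterm_mut, rterm_mut.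

Scheme cred_mut := Induction for cred Sort Prop
  with lred_mut := Induction for lred Sort Prop
  with rred_mut := Induction for rred Sort Prop.
Combined Scheme red_mutind from cred_mut, lred_mut, rred_mut.

(** * Algebra of renamings and substitutions *)

Lemma up_ll_var (xi : nat -> nat) :
  up_ll (fun n => lvar (xi n)) = fun n => lvar (up_ren xi n).
Proof. now extensionality n; destruct n. Qed.

Lemma up_rr_var (zeta : nat -> nat) :
  up_rr (fun n => rvar (zeta n)) = fun n => rvar (up_ren zeta n).
Proof. now extensionality n; destruct n. Qed.

(** Lets results on substitution, such as fusion and stability of reduction, transfer to
    renaming. *)
Lemma ren_subst_var :
  (forall c xi zeta,
     cren xi zeta c = csubst (fun n => lvar (xi n)) (fun n => rvar (zeta n)) c) /\
  (forall t xi zeta,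
     lren xi zeta t = lsubst (fun n => lvar (xi n)) (fun n => rvar (zeta n)) t) /\
  (forall u xi zeta,
     rren xi zeta u = rsubst (fun n => lvar (xi n)) (fun n => rvar (zeta n)) u).
Proof.
  apply term_mutind; simpl; intros; rewrite ?up_ll_var, ?up_rr_var;
    f_equal; auto.
Qed.

Lemma up_ll_up_ren (s : nat -> lterm) (xi : nat -> nat) :
  (fun n => up_ll s (up_ren xi n)) = up_ll (fun n => s (xi n)).
Proof. now extensionality n; destruct n. Qed.

Lemma up_rr_up_ren (r : nat -> rterm) (zeta : nat -> nat) :
  (fun n => up_rr r (up_ren zeta n)) = up_rr (fun n => r (zeta n)).
Proof. now extensionality n; destruct n. Qed.

(** First of three fusion laws. Substitution after renaming yields renaming after substitution, and
    both yield substitution after substitution: each law needs the earlier ones to pass under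
    binders. *)
Lemma subst_ren :
  (forall c xi zeta s r,
     csubst s r (cren xi zeta c) = csubst (fun n => s (xi n)) (fun n => r (zeta n)) c) /\
  (forall t xi zeta s r,
     lsubst s r (lren xi zeta t) = lsubst (fun n => s (xi n)) (fun n => r (zeta n)) t) /\
  (forall u xi zeta s r,
     rsubst s r (rren xi zeta u) = rsubst (fun n => s (xi n)) (fun n => r (zeta n)) u).
Proof.
  apply term_mutind; simpl; intros; f_equal; auto;
    (etransitivity; [eauto | now rewrite ?up_ll_up_ren, ?up_rr_up_ren]).
Qed.

Lemma lren_lren xi zeta xi' zeta' t :
  lren xi zeta (lren xi' zeta' t) = lren (fun n => xi (xi' n)) (fun n => zeta (zeta' n)) t.
Proof.
  destruct ren_subst_var as (_ & H & _), subst_ren as (_ & K & _).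
  now rewrite (H (lren _ _ _)), K, H.
Qed.

Lemma rren_rren xi zeta xi' zeta' u :
  rren xi zeta (rren xi' zeta' u) = rren (fun n => xi (xi' n)) (fun n => zeta (zeta' n)) u.
Proof.
  destruct ren_subst_var as (_ & _ & H), subst_ren as (_ & _ & K).
  now rewrite (H (rren _ _ _)), K, H.
Qed.

Lemma ren_up_ll xi zeta s :
  (fun n => lren (up_ren xi) zeta (up_ll s n)) = up_ll (fun n => lren xi zeta (s n)).
Proof. extensionality n; destruct n; simpl; now rewrite ?lren_lren. Qed.

Lemma ren_up_rl xi zeta s :
  (fun n => lren xi (up_ren zeta) (up_rl s n)) = up_rl (fun n => lren xi zeta (s n)).
Proof. extensionality n; unfold up_rl; now rewrite !lren_lren. Qed.

Lemma ren_up_rr xi zeta r :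
  (fun n => rren xi (up_ren zeta) (up_rr r n)) = up_rr (fun n => rren xi zeta (r n)).
Proof. extensionality n; destruct n; simpl; now rewrite ?rren_rren. Qed.

Lemma ren_up_lr xi zeta r :
  (fun n => rren (up_ren xi) zeta (up_lr r n)) = up_lr (fun n => rren xi zeta (r n)).
Proof. extensionality n; unfold up_lr; now rewrite !rren_rren. Qed.

Lemma ren_subst :
  (forall c xi zeta s r,
     cren xi zeta (csubst s r c) =
     csubst (fun n => lren xi zeta (s n)) (fun n => rren xi zeta (r n)) c) /\
  (forall t xi zeta s r,
     lren xi zeta (lsubst s r t) =
     lsubst (fun n => lren xi zeta (s n)) (fun n => rren xi zeta (r n)) t) /\
  (forall u xi zeta s r,
     rren xi zeta (rsubst s r u) =
     rsubst (fun n => lren xi zeta (s n)) (fun n => rren xi zeta (r n)) u).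
Proof.
  apply term_mutind; simpl; intros; f_equal; auto;
    (etransitivity;
     [eauto | now rewrite ?ren_up_ll, ?ren_up_rl, ?ren_up_rr, ?ren_up_lr]).
Qed.

Lemma subst_up_ll s r s' :
  (fun n => lsubst (up_ll s) (up_lr r) (up_ll s' n)) = up_ll (fun n => lsubst s r (s' n)).
Proof.
  destruct subst_ren as (_ & H & _), ren_subst as (_ & K & _).
  extensionality n; destruct n; simpl; now rewrite ?H, ?K.
Qed.

Lemma subst_up_rl s r s' :
  (fun n => lsubst (up_rl s) (up_rr r) (up_rl s' n)) = up_rl (fun n => lsubst s r (s' n)).
Proof.
  destruct subst_ren as (_ & H & _), ren_subst as (_ & K & _).
  extensionality n; unfold up_rl at 2 3; now rewrite H, K.
Qed.

Lemma subst_up_rr s r r' :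
  (fun n => rsubst (up_rl s) (up_rr r) (up_rr r' n)) = up_rr (fun n => rsubst s r (r' n)).
Proof.
  destruct subst_ren as (_ & _ & H), ren_subst as (_ & _ & K).
  extensionality n; destruct n; simpl; now rewrite ?H, ?K.
Qed.

Lemma subst_up_lr s r r' :
  (fun n => rsubst (up_ll s) (up_lr r) (up_lr r' n)) = up_lr (fun n => rsubst s r (r' n)).
Proof.
  destruct subst_ren as (_ & _ & H), ren_subst as (_ & _ & K).
  extensionality n; unfold up_lr at 2 3; now rewrite H, K.
Qed.

Lemma subst_subst :
  (forall c s r s' r',
     csubst s r (csubst s' r' c) =
     csubst (fun n => lsubst s r (s' n)) (fun n => rsubst s r (r' n)) c) /\
  (forall t s r s' r',
     lsubst s r (lsubst s' r' t) =
     lsubst (fun n => lsubst s r (s' n)) (fun n => rsubst s r (r' n)) t) /\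
  (forall u s r s' r',
     rsubst s r (rsubst s' r' u) =
     rsubst (fun n => lsubst s r (s' n)) (fun n => rsubst s r (r' n)) u).
Proof.
  apply term_mutind; simpl; intros; f_equal; auto;
    (etransitivity;
     [eauto | now rewrite ?subst_up_ll, ?subst_up_rl, ?subst_up_rr, ?subst_up_lr]).
Qed.

Lemma subst_var :
  (forall c, csubst lvar rvar c = c) /\
  (forall t, lsubst lvar rvar t = t) /\
  (forall u, rsubst lvar rvar u = u).
Proof.
  assert (Hl : up_ll lvar = lvar) by now extensionality n; destruct n.
  assert (Hr : up_rr rvar = rvar) by now extensionality n; destruct n.
  apply term_mutind; simpl; intros; rewrite ?Hl, ?Hr;
    f_equal; auto.
Qed.

(** The weakening in [up_rl] and [up_rr] cancels against the entry [u], so substituting under a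
    binder and then instantiating it is a single substitution. *)
Lemma csubst_scons_up_r s r s' u r' c :
  csubst s (scons u r) (csubst (up_rl s') (up_rr r') c) =
  csubst (fun n => lsubst s r (s' n)) (scons u (fun n => rsubst s r (r' n))) c.
Proof.
  destruct subst_subst as (H & _), subst_ren as (_ & Kl & Kr).
  rewrite H; f_equal; extensionality n.
  - unfold up_rl; now rewrite Kl.
  - destruct n; simpl; now rewrite ?Kr.
Qed.

Lemma csubst_scons_up_l s r t s' r' c :
  csubst (scons t s) r (csubst (up_ll s') (up_lr r') c) =
  csubst (scons t (fun n => lsubst s r (s' n))) (fun n => rsubst s r (r' n)) c.
Proof.
  destruct subst_subst as (H & _), subst_ren as (_ & Kl & Kr).
  rewrite H; f_equal; extensionality n.
  - destruct n; simpl; now rewrite ?Kl.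
  - unfold up_lr; now rewrite Kr.
Qed.

(** * Stability of reduction under substitution *)

Lemma csubst_csubst_r s r u c :
  csubst s r (csubst_r u c) =
  csubst_r (rsubst s r u) (csubst (up_rl s) (up_rr r) c).
Proof.
  destruct subst_subst as (H & _), subst_var as (_ & Il & Ir).
  unfold csubst_r; rewrite csubst_scons_up_r, H.
  f_equal; extensionality n; [|destruct n]; simpl; now rewrite ?Il, ?Ir.
Qed.

Lemma csubst_csubst_l s r t c :
  csubst s r (csubst_l t c) =
  csubst_l (lsubst s r t) (csubst (up_ll s) (up_lr r) c).
Proof.
  destruct subst_subst as (H & _), subst_var as (_ & Il & Ir).
  unfold csubst_l; rewrite csubst_scons_up_l, H.
  f_equal; extensionality n; [destruct n|]; simpl; now rewrite ?Il, ?Ir.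
Qed.

Lemma red_subst :
  (forall c c', cred c c' -> forall s r, cred (csubst s r c) (csubst s r c')) /\
  (forall t t', lred t t' -> forall s r, lred (lsubst s r t) (lsubst s r t')) /\
  (forall u u', rred u u' -> forall s r, rred (rsubst s r u) (rsubst s r u')).
Proof.
  apply red_mutind; simpl; intros;
    rewrite ?csubst_csubst_r, ?csubst_csubst_l; constructor; auto.
Qed.

(** * Strong normalization as accessibility *)

(** The inductive form gives induction on reducts; the relation is flipped so that reducts are the
    predecessors. *)
Definition sn {A : Type} (R : A -> A -> Prop) : A -> Prop := Acc (fun b a => R a b).

Lemma sn_strongly_normalizing {A : Type} (R : A -> A -> Prop) (a : A) :
  sn R a -> strongly_normalizing R a.
Proof.
  induction 1 as [a _ IH]; intros (f & <- & Hf).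
  apply (IH (f 1) (Hf 0)); now exists (fun n => f (S n)).
Qed.

Lemma sn_map {A B : Type} (R : A -> A -> Prop) (R' : B -> B -> Prop) (f : A -> B) :
  (forall a b, R' (f a) b -> exists a', b = f a' /\ R a a') ->
  forall a, sn R a -> sn R' (f a).
Proof.
  intros Hf a; induction 1 as [a _ IH]; constructor; intros b Hb.
  destruct (Hf a b Hb) as (a' & -> & Ha); now apply IH.
Qed.

Lemma sn_map2 {A B C : Type} (R : A -> A -> Prop) (R' : B -> B -> Prop)
    (R'' : C -> C -> Prop) (f : A -> B -> C) :
  (forall a b d, R'' (f a b) d ->
     (exists a', d = f a' b /\ R a a') \/ (exists b', d = f a b' /\ R' b b')) ->
  forall a b, sn R a -> sn R' b -> sn R'' (f a b).
Proof.
  intros Hf a b Ha; revert b; induction Ha as [a _ IHa].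
  induction 1 as [b Hb IHb]; constructor; intros d Hd.
  destruct (Hf a b d Hd) as [(a' & -> & Ha') | (b' & -> & Hb')].
  - apply IHa; [exact Ha' | now constructor].
  - now apply IHb.
Qed.

(** Only cuts can be redexes at the root, so every step from an l- or r-term comes from an immediate
    subterm. *)
Lemma sn_llam t : sn lred t -> sn lred (llam t).
Proof. apply sn_map; intros a b H; inversion H; eauto. Qed.

Lemma sn_lmu c : sn cred c -> sn lred (lmu c).
Proof. apply sn_map; intros a b H; inversion H; eauto. Qed.

Lemma sn_lapp u t : sn rred u -> sn lred t -> sn lred (lapp u t).
Proof. apply sn_map2; intros a b d H; inversion H; eauto. Qed.

Lemma sn_rlam u : sn rred u -> sn rred (rlam u).
Proof. apply sn_map; intros a b H; inversion H; eauto. Qed.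

Lemma sn_rmu c : sn cred c -> sn rred (rmu c).
Proof. apply sn_map; intros a b H; inversion H; eauto. Qed.

Lemma sn_rapp t u : sn lred t -> sn rred u -> sn rred (rapp t u).
Proof. apply sn_map2; intros a b d H; inversion H; eauto. Qed.

(** * Candidates and their fixed point *)

(* Quantifying over renamings makes the candidates stable under renaming, which
   is what going under a binder requires. *)
Definition lcand (Y : rterm -> Prop) (t : lterm) : Prop :=
  (forall xi zeta, sn lred (lren xi zeta t)) /\
  (forall c, t = lmu c -> forall xi zeta u, Y u ->
     sn cred (csubst (fun n => lvar (xi n)) (scons u (fun n => rvar (zeta n))) c)).

Definition rcand (X : lterm -> Prop) (u : rterm) : Prop :=
  (forall xi zeta, sn rred (rren xi zeta u)) /\
  (forall c, u = rmu c -> forall xi zeta t, X t ->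
     sn cred (csubst (scons t (fun n => lvar (xi n))) (fun n => rvar (zeta n)) c)).

Lemma lcand_antitone (Y Y' : rterm -> Prop) :
  (forall u, Y u -> Y' u) -> forall t, lcand Y' t -> lcand Y t.
Proof. intros HY t [H K]; split; eauto. Qed.

Lemma rcand_antitone (X X' : lterm -> Prop) :
  (forall t, X t -> X' t) -> forall u, rcand X' u -> rcand X u.
Proof. intros HX u [H K]; split; eauto. Qed.

(* The least fixed point of [fun P => lcand (rcand P)]. *)
Definition lgood (t : lterm) : Prop :=
  forall P : lterm -> Prop, (forall t, lcand (rcand P) t -> P t) -> P t.

(** With this choice one of the two fixed-point equations holds by definition. *)
Definition rgood : rterm -> Prop := rcand lgood.

(** Knaster-Tarski: [lgood] lies below each pre-fixed [P], so by monotonicity [lcand (rcand lgood)]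
    lies below [lcand (rcand P)], hence below [P]. *)
Lemma lcand_lgood t : lcand rgood t -> lgood t.
Proof.
  intros H P HP; apply HP; revert t H.
  apply lcand_antitone, rcand_antitone; intros t H; now apply H.
Qed.

(** By monotonicity and the previous lemma, [lcand rgood] is itself pre-fixed, so leastness applies
    to it. *)
Lemma lgood_lcand t : lgood t -> lcand rgood t.
Proof.
  intros H; apply H; apply lcand_antitone, rcand_antitone; exact lcand_lgood.
Qed.

(** * Closure properties of good terms *)

Lemma lgood_sn t : lgood t -> sn lred t.
Proof.
  intros [H _]%lgood_lcand; specialize (H (fun n => n) (fun n => n)).
  destruct ren_subst_var as (_ & E & _), subst_var as (_ & I & _).
  now rewrite E, I in H.
Qed.

Lemma rgood_sn u : rgood u -> sn rred u.
Proof.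
  intros [H _]; specialize (H (fun n => n) (fun n => n)).
  destruct ren_subst_var as (_ & _ & E), subst_var as (_ & _ & I).
  now rewrite E, I in H.
Qed.

Lemma lgood_ren xi zeta t : lgood t -> lgood (lren xi zeta t).
Proof.
  intros [H K]%lgood_lcand; apply lcand_lgood; split.
  - intros xi' zeta'; rewrite lren_lren; apply H.
  - intros c E xi' zeta' u Hu; destruct t; try discriminate.
    injection E as <-; destruct subst_ren as (S & _); rewrite S.
    (* [up_ren zeta] fixes index 0, so [u] is still what replaces the bound variable. *)
    replace (fun n => scons u _ (up_ren zeta n))
      with (scons u (fun n => rvar (zeta' (zeta n))))
      by now extensionality n; destruct n.
    now apply K.
Qed.

Lemma rgood_ren xi zeta u : rgood u -> rgood (rren xi zeta u).
Proof.
  intros [H K]; split.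
  - intros xi' zeta'; rewrite rren_rren; apply H.
  - intros c E xi' zeta' t Ht; destruct u; try discriminate.
    injection E as <-; destruct subst_ren as (S & _); rewrite S.
    replace (fun n => scons t _ (up_ren xi n))
      with (scons t (fun n => lvar (xi' (xi n))))
      by now extensionality n; destruct n.
    now apply K.
Qed.

Lemma lgood_red t t' : lred t t' -> lgood t -> lgood t'.
Proof.
  intros R [H K]%lgood_lcand; apply lcand_lgood; split.
  - intros xi zeta; apply (Acc_inv (H xi zeta)).
    destruct ren_subst_var as (_ & E & _); rewrite !E; now apply red_subst.
  (* No rule acts at the root of an l-term, so a reduct that is a mu comes from some [lmu c] whose
     body makes the step. *)
  - intros c' -> xi zeta u Hu; inversion R as [|c c'' Rc| |]; subst.
    refine (Acc_inv (K c eq_refl xi zeta u Hu) _); now apply red_subst.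
Qed.

Lemma rgood_red u u' : rred u u' -> rgood u -> rgood u'.
Proof.
  intros R [H K]; split.
  - intros xi zeta; apply (Acc_inv (H xi zeta)).
    destruct ren_subst_var as (_ & _ & E); rewrite !E; now apply red_subst.
  - intros c' -> xi zeta t Ht; inversion R as [|c c'' Rc| |]; subst.
    refine (Acc_inv (K c eq_refl xi zeta t Ht) _); now apply red_subst.
Qed.

(** Nested induction on the normalization of [t] and [u]. Steps inside either side stay good; the
    two contractions, even when both apply, are settled by the candidate clauses alone. *)
Lemma sn_cut t u : lgood t -> rgood u -> sn cred (cut t u).
Proof.
  intros Gt Gu.
  pose proof (lgood_sn t Gt) as St; pose proof (rgood_sn u Gu) as Su.
  revert u Gu Su; induction St as [t _ IHt]; intros u Gu Su.
  induction Su as [u Su IHu]; constructor; intros d R.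
  inversion R as [c u0 | t0 c | t0 t' u0 Rt | t0 u0 u' Ru]; subst.
  (* With identity renamings the clause is about [csubst_r u c] itself. *)
  - exact (proj2 (lgood_lcand _ Gt) c eq_refl (fun n => n) (fun n => n) u Gu).
  - exact (proj2 Gu c eq_refl (fun n => n) (fun n => n) t Gt).
  - apply IHt; [exact Rt | now apply lgood_red with t | exact Gu | now constructor].
  - apply IHu; [exact Ru | now apply rgood_red with u].
Qed.

Lemma lgood_var n : lgood (lvar n).
Proof.
  apply lcand_lgood; split; [|discriminate].
  intros xi zeta; constructor; intros t R; inversion R.
Qed.

Lemma rgood_var n : rgood (rvar n).
Proof.
  split; [|discriminate].
  intros xi zeta; constructor; intros t R; inversion R.
Qed.

(** * Good substitutions and the main induction *)

Lemma lgood_scons t s :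
  lgood t -> (forall n, lgood (s n)) -> forall n, lgood (scons t s n).
Proof. now intros Ht Hs [|n]; simpl. Qed.

Lemma rgood_scons u r :
  rgood u -> (forall n, rgood (r n)) -> forall n, rgood (scons u r n).
Proof. now intros Hu Hr [|n]; simpl. Qed.

Create HintDb good.
#[local] Hint Resolve lgood_sn rgood_sn lgood_ren rgood_ren lgood_var rgood_var
  sn_llam sn_lmu sn_lapp sn_rlam sn_rmu sn_rapp sn_cut : good.

Lemma good_subst :
  (forall c s r, (forall n, lgood (s n)) -> (forall n, rgood (r n)) ->
     sn cred (csubst s r c)) /\
  (forall t s r, (forall n, lgood (s n)) -> (forall n, rgood (r n)) ->
     lgood (lsubst s r t)) /\
  (forall u s r, (forall n, lgood (s n)) -> (forall n, rgood (r n)) ->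
     rgood (rsubst s r u)).
Proof.
  (* Good substitutions stay good under binders, because goodness is stable under renaming. *)
  assert (Ull : forall s, (forall n, lgood (s n)) -> forall n, lgood (up_ll s n)).
  { intros s Hs; apply lgood_scons; auto with good. }
  assert (Urr : forall r, (forall n, rgood (r n)) -> forall n, rgood (up_rr r n)).
  { intros r Hr; apply rgood_scons; auto with good. }
  assert (Url : forall s, (forall n, lgood (s n)) -> forall n, lgood (up_rl s n)).
  { intros s Hs n; apply lgood_ren, Hs. }
  assert (Ulr : forall r, (forall n, rgood (r n)) -> forall n, rgood (up_lr r n)).
  { intros r Hr n; apply rgood_ren, Hr. }
  destruct ren_subst as (Rc & _), ren_subst_var as (_ & Vl & Vr).
  apply term_mutind; simpl; auto with good.
  (* Away from mu the second candidate clause is vacuous, leaving only normalization of the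
     renamings. *)
  - intros t IH s r Hs Hr; apply lcand_lgood; split; [simpl | discriminate].
    auto 10 with good.
  - intros c IH s r Hs Hr; apply lcand_lgood; split; simpl.
    (* The outer renaming is absorbed into the substitution, to which [IH] applies. *)
    + intros xi zeta; rewrite Rc; apply sn_lmu, IH; auto with good.
    (* Fusion presents the instantiated body as [c] under a good substitution extended by [u]. *)
    + intros c' [= <-] xi zeta u Hu; rewrite csubst_scons_up_r.
      apply IH; [|apply rgood_scons; [exact Hu|]]; intros n.
      * rewrite <- Vl; auto with good.
      * rewrite <- Vr; auto with good.
  - intros u IHu t IHt s r Hs Hr; apply lcand_lgood; split; [simpl | discriminate].
    auto 10 with good.
  - intros u IH s r Hs Hr; split; [simpl | discriminate].
    auto 10 with good.
  - intros c IH s r Hs Hr; split; simpl.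
    + intros xi zeta; rewrite Rc; apply sn_rmu, IH; auto with good.
    + intros c' [= <-] xi zeta t Ht; rewrite csubst_scons_up_l.
      apply IH; [apply lgood_scons; [exact Ht|]|]; intros n.
      * rewrite <- Vl; auto with good.
      * rewrite <- Vr; auto with good.
  - intros t IHt u IHu s r Hs Hr; split; [simpl | discriminate].
    auto 10 with good.
Qed.

Theorem theorem3p13 :
  (forall c : cterm, strongly_normalizing cred c) /\
  (forall t : lterm, strongly_normalizing lred t) /\
  (forall u : rterm, strongly_normalizing rred u).
Proof.
  destruct good_subst as (Gc & Gl & Gr), subst_var as (Ic & Il & Ir).
  split; [|split]; intros a; apply sn_strongly_normalizing.
  (* Variables are good, so the identity substitution is a good one. *)
  - rewrite <- Ic; auto with good.
  - rewrite <- Il; auto with good.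
  - rewrite <- Ir; auto with good.
Qed.
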